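(* Let $\ell\ge 1$ be an integer and $\varepsilon>0$. Let $\omega$ be the period-doubling sequence. Then the recurrence rate $\mathrm{RR}_\ell(\omega,\varepsilon)=\lim_{n\to\infty}\mathrm{RR}_\ell(\omega,n,\varepsilon)$ exists and $$\mathrm{RR}_\ell(\omega,\varepsilon)=\begin{cases}1 & \text{if } m_\varepsilon=0;\\ 5/9 & \text{if } m_\varepsilon=1\text{ and }\ell=1;\\ (3\cdot 2^{k+1}-4q+4\ell-4)/\left((3\cdot 2^k)^2\right) & \text{if } m_\varepsilon\ge 1,\ m_\varepsilon+\ell\ge 3\text{ and } q<2^{k-1};\\ (5\cdot 2^k-2q+2\ell-2)/\left((3\cdot 2^k)^2\right) & \text{if } m_\varepsilon\ge 1,\ m_\varepsilon+\ell\ge 3\text{ and } q\ge 2^{k-1};\end{cases}$$ where, for $m_\varepsilon+\ell\ge 3$, $k\ge 1$ and $0\le q<2^k$ are the unique integers such that $m_\varepsilon+\ell-1=2^k+q$.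
   Context: The period-doubling sequence $\omega=\omega_1\omega_2\ldots=0100\,0101\,0100\,0100\ldots$ is the unique fixed point in $\{0,1\}^{\mathbb{N}}$ ($\mathbb{N}=\{1,2,\dots\}$) of the substitution $0\mapsto 01$, $1\mapsto 00$; equivalently, $\omega_i=k_i\bmod 2$, where $k_i$ is the largest integer such that $2^{k_i}$ divides $i$. On $\{0,1\}^{\mathbb{N}}$ use the metric $\rho(\alpha,\beta)=0$ if $\alpha=\beta$ and $\rho(\alpha,\beta)=2^{-k+1}$ with $k=\min\{i:\alpha_i\ne\beta_i\}$ if $\alpha\ne\beta$, and the shift $\sigma(\alpha_1\alpha_2\alpha_3\ldots)=\alpha_2\alpha_3\ldots$. For $\ell\ge1$ let $\rho_\ell(\alpha,\beta)=\max_{0\le k<\ell}\rho(\sigma^k(\alpha),\sigma^k(\beta))$ (Bowen's metric), and for $x \in \{0,1\}^{\mathbb{N}}$, $n\in\mathbb{N}$, $\varepsilon>0$ let $\mathrm{C}_\ell(x,n,\varepsilon)=\frac1{n^2}\#\{(i,j):0\le i,j<n,\ \rho_\ell(\sigma^i(x),\sigma^j(x))\le\varepsilon\}$. The recurrence rate (with minimal required line length $\ell$, embedding dimension $1$) is $\mathrm{RR}_\ell(x,n,\varepsilon)=\ell\cdot \mathrm{C}_\ell(x,n,\varepsilon)-(\ell-1)\cdot \mathrm{C}_{\ell+1}(x,n,\varepsilon)$, and $\mathrm{RR}_\ell(x,\varepsilon)$ denotes its limit as $n\to\infty$ when it exists. For $\varepsilon>0$: $m_\varepsilon=0$ if $\varepsilon\ge1$;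 otherwise $m_\varepsilon$ is the unique positive integer with $2^{-m_\varepsilon}\le\varepsilon<2^{-m_\varepsilon+1}$. *)

(* Defs.v *)
From HB Require Import structures.
From mathcomp Require Import all_boot all_order all_algebra.
From mathcomp Require Import all_classical all_reals all_analysis.

Set Implicit Arguments.
Unset Strict Implicit.
Unset Printing Implicit Defensive.

Import Order.TTheory GRing.Theory Num.Theory.
Import numFieldNormedType.Exports.

Local Open Scope classical_set_scope.
Local Open Scope ring_scope.

(* Binary sequences are indexed from 0: for a : binseq, [a i] is the letter of
   index i + 1 in the usual numbering from 1; false is 0 and true is 1. *)
Definition binseq := nat -> bool.

Definition shift (a : binseq) : binseq := fun i => a i.+1.

(* 0 |-> 01, 1 |-> 00 *)
Definition pd_letter (b : bool) : seq bool :=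
  if b then [:: false; false] else [:: false; true].

Definition pd_subst (a : binseq) : binseq :=
  fun i => nth false (pd_letter (a i./2)) (odd i).

Definition period_doubling : binseq := fun i => odd (logn 2 i.+1).

Lemma pd_substE (a : binseq) (i : nat) :
  pd_subst a i = odd i && ~~ a i./2.
Proof. by rewrite /pd_subst; case: (a _); case: (odd i). Qed.

Lemma period_doublingE (i : nat) :
  period_doubling i = odd i && ~~ period_doubling i./2.
Proof.
rewrite /period_doubling; case: (boolP (odd i)) => /= oi.
  have -> : i.+1 = (2 * (i./2).+1)%N.
    by rewrite mul2n doubleS -[in LHS](odd_double_half i) oi add1n.
  by rewrite lognM // lognE /= addSn.
by rewrite logn_coprime // coprime2n /= oi.
Qed.

Lemma period_doubling_unique_fixpoint (a : binseq) :
  pd_subst a = a <-> a = period_doubling.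
Proof.
split=> [fa|->]; apply/funext => i; last by rewrite pd_substE -period_doublingE.
elim/ltn_ind: i => i IH.
rewrite -fa pd_substE period_doublingE.
case: (boolP (odd i)) => //= oi; rewrite IH //.
by case: i oi {IH} => // i _; rewrite ltnS /= leq_uphalf_double -addnn leq_addr.
Qed.

Section RecurrenceRate.
Variable R : realType.

(* For sequences first differing at 0-based position k0, the usual 1-based
   position is k = k0 + 1, so that 2 ^ (- k + 1) = 2 ^ (- k0). *)
Definition rho (a b : binseq) : R :=
  match pselect (exists i, a i != b i) with
  | left neq => 2 ^- ex_minn neq
  | right _ => 0
  end.

Lemma rho_eq (a : binseq) : rho a a = 0.
Proof. rewrite /rho; case: pselect => // h; exfalso; by case: h => i; rewrite eqxx. Qed.

Lemma rho_first_diff (a b : binseq) (k : nat) :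
  a k != b k -> (forall i, (i < k)%N -> a i = b i) -> rho a b = 2 ^- k.
Proof.
move=> dk eqk; rewrite /rho; case: pselect => [h|[]]; last by exists k.
case: ex_minnP => m dm /(_ _ dk) mk; congr (_ ^- _).
apply/eqP; rewrite eqn_leq mk leqNgt; apply/negP => /eqk e.
by rewrite e eqxx in dm.
Qed.

(* The default 0 is harmless: rho is nonnegative and l >= 1 is intended. *)
Definition bowen (l : nat) (a b : binseq) : R :=
  \big[Num.max/0]_(k < l) rho (iter k shift a) (iter k shift b).

Definition corr_sum (l : nat) (x : binseq) (n : nat) (eps : R) : R :=
  #|[set p : 'I_n * 'I_n |
      bowen l (iter p.1 shift x) (iter p.2 shift x) <= eps]%SET|%:R / n%:R ^+ 2.

Definition rec_rate (l : nat) (x : binseq) (n : nat) (eps : R) : R :=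
  l%:R * corr_sum l x n eps - (l%:R - 1) * corr_sum l.+1 x n eps.

Definition rec_rate_lim (l : nat) (x : binseq) (eps : R) : R :=
  limn (fun n => rec_rate l x n eps).

Definition is_m_eps (eps : R) (m : nat) : Prop :=
  if 1 <= eps then m = 0%N
  else (0 < m)%N /\ 2 ^- m <= eps < 2 ^- m.-1.

Lemma is_m_eps_unique (eps : R) : 0 < eps -> exists! m, is_m_eps eps m.
Proof.
move=> e0; rewrite /is_m_eps; case: (boolP (1 <= eps)) => [_|].
  by exists 0%N; split.
rewrite -ltNge => e1.
have dec (i j : nat) : (i <= j)%N -> 2 ^- j <= 2 ^- i :> R.
  by move=> ij; rewrite lef_pV2 ?posrE ?exprn_gt0// ler_weXn2l// ler1n.
have ex : exists n, 2 ^- n <= eps.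
  exists (Num.truncn eps^-1).+1.
  rewrite -[leRHS]invrK lef_pV2 ?posrE ?exprn_gt0 ?invr_gt0//.
  apply: (le_trans (ltW (truncnS_gt _))).
  by rewrite -natrX ler_nat ltnW// ltn_expl.
case: (ex_minnP ex) => m Pm minm.
have m0 : (0 < m)%N.
  by case: m Pm {minm} => //; rewrite expr0 invr1 leNgt e1.
exists m; split.
  split=> //; rewrite Pm /= ltNge; apply/negP => /minm.
  by rewrite leqNgt prednK ?leqnn.
move=> j [j0 /andP[Pj ltj]]; apply/eqP; rewrite eqn_leq minm//= leqNgt.
apply/negP => mj; move: ltj; rewrite ltNge; case/negP.
apply: le_trans Pm; apply: dec; by rewrite -ltnS prednK.
Qed.

Definition m_eps (eps : R) : nat := xget 0%N [set m | is_m_eps eps m].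

Lemma m_epsP (eps : R) : 0 < eps -> is_m_eps eps (m_eps eps).
Proof.
by move=> /is_m_eps_unique[m [Pm _]]; rewrite /m_eps; case: xgetP => // /(_ m).
Qed.

End RecurrenceRate.

Arguments rho {R}.
Arguments bowen {R}.
Arguments corr_sum {R}.
Arguments rec_rate {R}.
Arguments rec_rate_lim {R}.

Definition is_dyadic_split (n k q : nat) : Prop :=
  [/\ (1 <= k)%N, (q < 2 ^ k)%N & n = (2 ^ k + q)%N].

Lemma dyadic_split_unique (n : nat) : (2 <= n)%N ->
  exists! kq : nat * nat, is_dyadic_split n kq.1 kq.2.
Proof.
move=> n2; have n0 : (0 < n)%N by apply: ltnW.
have /andP[lo hi] := trunc_log_bounds (isT : (1 < 2)%N) n0.
exists (trunc_log 2 n, n - 2 ^ trunc_log 2 n)%N; split=> /=.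
  split; first by rewrite trunc_log_gt0 n2.
    by rewrite ltn_subLR// addnn -mul2n -expnS.
  by rewrite subnKC.
move=> [k q] /= [k1 qk ->]; suff -> : trunc_log 2 (2 ^ k + q) = k.
  by rewrite addKn.
by apply: trunc_log_eq => //; rewrite leq_addr expnS mul2n -addnn ltn_add2l.
Qed.

(* Main.v *)
Require Import Defs.
From HB Require Import structures.
From mathcomp Require Import all_boot all_order all_algebra.
From mathcomp Require Import all_classical all_reals all_analysis.
From mathcomp Require Import zify ring lra.

(** Write w for the period-doubling sequence. Any two points are eps-close if
    m = 0, and then the recurrence rate is l - (l - 1) = 1. Let m >= 1. Two
    points are eps-close exactly when they share their first m letters, so
    w_i w_(i+1)... and w_j w_(j+1)... are eps-close in Bowen's metric exactly
    when the blocks of length N = m + l - 1 starting at i and j coincide. Hence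
    the correlation sums of order l and l + 1 tend to c(N) and c(N + 1), where
    c(N) is the density of the pairs (i, j) with equal blocks of length N, and
    the recurrence rate is c(N) + (l - 1) (c(N) - c(N + 1)).

    The densities c(N) come from the self-similarity w_(2i) = 0,
    w_(2i+1) = 1 - w_i (indices from 0). Sort the pairs by the parities of i
    and j. Inside a class of equal parities only the odd positions of the two
    blocks carry information, and they compare blocks of half the length. If
    the parities differ, every odd position of one block meets a 0 of the
    other; for N >= 3 this would force the factor 11 in w, which does not
    occur. Therefore
      c(N) = (c(floor (N / 2)) + c(ceil (N / 2))) / 4   for N >= 3,
    which is [block_density_halves]. The initial values c(1) = 5/9 and
    c(2) = 1/3 follow from the frequency 1/3 of the letter 1.

    The recurrence turns an affine formula valid on an interval [a, b] into an
    affine formula valid on [2a, 2b], because the two halves of N add up to N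
    ([affine_block_density_double]). Starting from [2, 3] and [3, 4], this
    makes c affine on [2^k, 3 2^(k-1)] and on [3 2^(k-1), 2^(k+1)]. For N >= 2,
    both N and N + 1 lie in one of these intervals, so evaluating the
    recurrence rate is a computation with an affine function, and the two
    intervals are the two cases for q. *)

Import Order.TTheory GRing.Theory Num.Theory.
Import numFieldNormedType.Exports.

Local Open Scope classical_set_scope.
Local Open Scope ring_scope.

(** * Densities of relations on the natural numbers *)

Definition pair_count (P : rel nat) (n : nat) : nat :=
  (\sum_(i < n) \sum_(j < n) P i j)%N.

Definition pair_density (R : realType) (P : rel nat) (c : R) : Prop :=
  (fun n => (pair_count P n)%:R / n%:R ^+ 2 : R) @ \oo --> c.

Lemma sum_double (F : nat -> nat) (n : nat) :
  (\sum_(i < n.*2) F i = \sum_(i < n) (F i.*2 + F i.*2.+1))%N.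
Proof.
elim: n => [|n IH]; first by rewrite !big_ord0.
by rewrite doubleS !big_ord_recr /= IH addnA.
Qed.

Lemma pair_count_double (P : rel nat) (n : nat) :
  pair_count P n.*2 = (pair_count (fun i j => P i.*2 j.*2) n
    + pair_count (fun i j => P i.*2 j.*2.+1) n
    + pair_count (fun i j => P i.*2.+1 j.*2) n
    + pair_count (fun i j => P i.*2.+1 j.*2.+1) n)%N.
Proof.
rewrite /pair_count (sum_double (fun i => \sum_(j < n.*2) P i j)%N).
rewrite -!big_split /=.
apply: eq_bigr => i _; rewrite (sum_double (P i.*2)) (sum_double (P i.*2.+1)).
by rewrite !big_split /= !addnA.
Qed.

Lemma pair_count_le (P : rel nat) (n : nat) : (pair_count P n <= n ^ 2)%N.
Proof.
rewrite /pair_count.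
have : (\sum_(i < n) \sum_(j < n) P i j <= \sum_(i < n) \sum_(j < n) 1)%N.
  by apply: leq_sum => i _; apply: leq_sum => j _; case: (P i j).
by rewrite !sum_nat_const !card_ord muln1.
Qed.

Lemma pair_countS_bounds (P : rel nat) (n : nat) :
  (pair_count P n <= pair_count P n.+1 <= pair_count P n + n.*2.+1)%N.
Proof.
have -> : pair_count P n.+1 = (pair_count P n
    + (\sum_(i < n) P i n + (\sum_(j < n) P n j + P n n)))%N.
  rewrite /pair_count big_ord_recr /= big_ord_recr /= !addnA.
  congr (_ + _ + _)%N; rewrite -big_split.
  by apply: eq_bigr => i _; rewrite big_ord_recr.
rewrite leq_addr leq_add2l /=.
have le1 (F : nat -> bool) : (\sum_(i < n) F i <= n)%N.
  rewrite -[leqRHS]muln1 -[in leqRHS](card_ord n) -sum_nat_const.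
  by apply: leq_sum => i _; case: (F i).
have := le1 (fun i => P i n); have := le1 (fun j => P n j).
by case: (P n n) => /=; lia.
Qed.

(** Dropping the last index of an odd window changes the count by at most
    2k + 1 out of about k ^ 2 pairs, so even window sizes decide the limit. *)
Lemma pair_density_even (R : realType) (P : rel nat) (c : R) :
  (fun n => (pair_count P n.*2)%:R / n.*2%:R ^+ 2 : R) @ \oo --> c ->
  pair_density R P c.
Proof.
move=> hc; rewrite /pair_density.
set u := fun n => (pair_count P n)%:R / n%:R ^+ 2 : R.
have hhalf : (fun n => u (n./2).*2) @ \oo --> c.
  have -> : (fun n => u (n./2).*2) = (fun n => u n.*2) \o (fun n => n %/ 2)%N.
    by apply/funext => n /=; rewrite divn2.
  by apply: cvg_comp hc; apply: cvg_divnr.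
apply: cvg_sub0 hhalf.
(* The difference between the windows n and 2 (n / 2) is at most 2 / n. *)
have hup : (fun n => 2 * (n%:R : R)^-1) @ \oo --> (0 : R).
  rewrite -[X in _ --> X](mulr0 (2 : R)); apply: cvgMr.
  by rewrite -cvg_shiftS; apply: cvg_harmonic.
apply/norm_cvg0P; apply: (squeeze_cvgr _ _ hup); last exact: cvg_cst.
near=> n.
have n0 : (0 < n)%N by near: n; exists 1%N.
rewrite normr_ge0 /=.
have [en|en] : n = (n./2).*2 \/ n = (n./2).*2.+1.
- by have := odd_double_half n; case: (odd n); [right|left].
- by rewrite !fctE -en subrr normr0 divr_ge0.
rewrite !fctE; move: en; move: (n./2).*2 => k ->.
have := pair_countS_bounds P k; have := pair_count_le P k.
rewrite -(ler_nat R) natrX => ale /andP[].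
rewrite -!(ler_nat R) natrD -[k.*2.+1]addn1 natrD -mul2n natrM => le_ab le_ba.
rewrite /u -[k.+1]addn1 natrD addn1.
set t := _ / k%:R ^+ 2.
(* Stating the count as t * k ^ 2 with 0 <= t <= 1 also covers k = 0, where the
   quotient t is 0 by convention. *)
have [t0 t1 at2] : [/\ 0 <= t, t <= 1 & (pair_count P k)%:R = t * k%:R ^+ 2].
  have [k0|k0] := eqVneq k 0%N.
    have a0 : (pair_count P k)%:R = 0 :> R.
      by apply/le_anti; rewrite ler0n andbT; move: ale; rewrite k0 expr0n.
    by rewrite /t a0 !mul0r; split.
  have kp : 0 < (k%:R : R) ^+ 2 by rewrite exprn_gt0 // ltr0n lt0n.
  by rewrite /t divr_ge0 // ler_pdivrMr // mul1r ale divfK // gt_eqF.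
have kge : 0 <= k%:R :> R by [].
have -> : (pair_count P k.+1)%:R / (k%:R + 1) ^+ 2 - t
    = ((pair_count P k.+1)%:R - t * (k%:R + 1) ^+ 2) / (k%:R + 1) ^+ 2.
  by field; lra.
rewrite normrM normfV [`|_ ^+ 2|]ger0_norm ?sqr_ge0 //.
rewrite ler_pdivrMr ?exprn_gt0 ?ltr_wpDl //.
have -> : 2 / (k%:R + 1) * (k%:R + 1) ^+ 2 = 2 * (k%:R + 1) :> R by field; lra.
by rewrite ler_norml; apply/andP; split; nra.
Unshelve. all: by end_near.
Qed.

(** The density of a relation is the mean of its densities on the four parity
    classes of pairs; this is what converts self-similarity into a recurrence.
*)
Lemma pair_density_double (R : realType) (P : rel nat) (c00 c01 c10 c11 : R) :
  pair_density R (fun i j => P i.*2 j.*2) c00 ->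
  pair_density R (fun i j => P i.*2 j.*2.+1) c01 ->
  pair_density R (fun i j => P i.*2.+1 j.*2) c10 ->
  pair_density R (fun i j => P i.*2.+1 j.*2.+1) c11 ->
  pair_density R P ((c00 + c01 + c10 + c11) / 4).
Proof.
move=> h00 h01 h10 h11; apply: pair_density_even.
apply: cvg_trans (cvgM (cvgD (cvgD (cvgD h00 h01) h10) h11)
  (cvg_cst (4^-1 : R))).
apply: near_eq_cvg; exists 1%N => // n /= n0.
have {}n0 : n%:R != 0 :> R by rewrite pnatr_eq0 -lt0n.
rewrite !fctE pair_count_double !natrD -muln2 natrM.
by field.
Qed.

Lemma pair_density_ext (R : realType) (P Q : rel nat) (c : R) :
  (forall i j, P i j = Q i j) -> pair_density R P c -> pair_density R Q c.
Proof.
by move=> PQ; suff -> : P = Q by []; apply/funext => i; apply/funext.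
Qed.

Lemma pair_density_false (R : realType) : pair_density R (fun _ _ => false) 0.
Proof.
apply: cvg_trans (@cvg_cst R 0 nat \oo _); apply: near_eq_cvg; near=> n.
by rewrite /pair_count big1 ?mul0r // => i _; rewrite big1.
Unshelve. all: by end_near.
Qed.

Lemma pair_density_true (R : realType) : pair_density R (fun _ _ => true) 1.
Proof.
apply: cvg_trans (@cvg_cst R 1 nat \oo _); apply: near_eq_cvg.
exists 1%N => // n /= n0; rewrite /pair_count !sum_nat_const !card_ord muln1.
by rewrite natrM -expr2 divff // expf_neq0 // pnatr_eq0 -lt0n.
Qed.

Definition frequency (R : realType) (a : pred nat) (c : R) : Prop :=
  (fun n => (\sum_(i < n) a i)%N%:R / n%:R : R) @ \oo --> c.

Lemma pair_count_prod (a b : pred nat) (n : nat) :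
  pair_count (fun i j => a i && b j) n
  = ((\sum_(i < n) a i) * (\sum_(j < n) b j))%N.
Proof.
rewrite /pair_count big_distrl; apply: eq_bigr => i _.
by rewrite big_distrr; apply: eq_bigr => j _; case: (a i); case: (b j).
Qed.

Lemma pair_density_prod (R : realType) (a b : pred nat) (c d : R) :
  frequency R a c -> frequency R b d ->
  pair_density R (fun i j => a i && b j) (c * d).
Proof.
move=> ha hb; rewrite /pair_density.
under eq_fun => n do rewrite pair_count_prod natrM expr2 invfM mulrACA.
exact: cvgM.
Qed.

Lemma pair_density_disjoint (R : realType) (P Q : rel nat) (c d : R) :
  (forall i j, ~~ (P i j && Q i j)) ->
  pair_density R P c -> pair_density R Q d ->
  pair_density R (fun i j => P i j || Q i j) (c + d).
Proof.
move=> PQ hP hQ; rewrite /pair_density.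
have E n : pair_count (fun i j => P i j || Q i j) n
    = (pair_count P n + pair_count Q n)%N.
  rewrite /pair_count -big_split; apply: eq_bigr => i _ /=.
  rewrite -big_split; apply: eq_bigr => j _ /=.
  by have := PQ i j; case: (P i j); case: (Q i j).
under eq_fun => n do rewrite E natrD mulrDl.
exact: cvgD.
Qed.

Lemma frequency_negb (R : realType) (a : pred nat) (c : R) :
  frequency R a c -> frequency R (fun i => ~~ a i) (1 - c).
Proof.
move=> ha; rewrite /frequency.
have E n : (\sum_(i < n) ~~ a i)%N%:R = n%:R - (\sum_(i < n) a i)%N%:R :> R.
  apply/eqP; rewrite eq_sym subr_eq -natrD -big_split /=.
  rewrite -[X in X%:R == _](card_ord n) -sum1_card eqr_nat; apply/eqP.
  by apply: eq_bigr => i _; case: (a i).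
apply: (cvg_trans _ (cvgB (cvg_cst (1 : R)) ha)).
apply: near_eq_cvg; exists 1%N => // n /= n0; rewrite !fctE E mulrBl divff //.
by rewrite pnatr_eq0 -lt0n.
Qed.

(** * Self-similarity of the period-doubling sequence *)

Lemma pd_even (i : nat) : period_doubling i.*2 = false.
Proof. by rewrite period_doublingE odd_double. Qed.

Lemma pd_odd (i : nat) : period_doubling i.*2.+1 = ~~ period_doubling i.
Proof. by rewrite period_doublingE /= odd_double uphalf_double. Qed.

(** Passing from n to n / 2 changes the sign of the discrepancy e, up to an
    error of 1 when n is odd. The square-root bound survives this step because
    (|e| + 1) ^ 2 <= 2 e ^ 2 + 2, and it is more than enough for a frequency.
*)
Lemma pd_ones_discrepancy (n : nat) (e : int) :
  e = 3 * (\sum_(i < n) period_doubling i)%N%:Z - n%:Z -> e ^+ 2 <= 2 * n%:Z.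
Proof.
elim/ltn_ind: n e => n IH e ->.
have ones2 m : (\sum_(i < m.*2) period_doubling i
    + \sum_(i < m) period_doubling i = m)%N.
  rewrite (sum_double (fun i => period_doubling i)) -big_split /=.
  rewrite -[RHS](card_ord m) -sum1_card.
  by apply: eq_bigr => i _; rewrite pd_even pd_odd; case: period_doubling.
have [->|n0] := eqVneq n 0%N; first by rewrite big_ord0.
have lt_half : (n./2 < n)%N by rewrite -divn2 ltn_Pdiv // lt0n.
have {IH} := IH _ lt_half _ erefl; have := ones2 n./2.
have := odd_double_half n; move: (odd n) (n./2) => b m <- {n n0 lt_half}.
case: b; rewrite ?add1n ?add0n ?big_ord_recr /= ?pd_even;
  move: (\sum_(i < m.*2) _)%N (\sum_(i < m) _)%N => s t; nia.
Qed.

Lemma pd_frequency (R : realType) : frequency R period_doubling (1 / 3 : R).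
Proof.
apply/cvgrPdist_le => d d0.
exists (Num.truncn (d ^- 2)).+1 => // n /= hn.
have n0 : 0 < n%:R :> R by rewrite ltr0n; apply: leq_trans hn.
have nd : d ^- 2 <= n%:R.
  by apply: (le_trans (ltW (truncnS_gt _))); rewrite ler_nat.
have := pd_ones_discrepancy n _ erefl.
move: (\sum_(i < n) _)%N => s.
rewrite -(ler_int R) rmorphXn rmorphB !rmorphM /= => h.
have -> : 1 / 3 - s%:R / n%:R = (n%:R - 3 * s%:R) / (3 * n%:R) :> R.
  by field; lra.
rewrite normrM normfV [`|3 * _|]ger0_norm ?mulr_ge0 // ler_pdivrMr ?mulr_gt0 //.
have d1 : 0 <= d by apply: ltW.
rewrite -(ler_pXn2r (ltn0Sn 1)) ?nnegrE ?mulr_ge0 // real_normK ?num_real //.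
have d2n : 1 <= d ^+ 2 * n%:R.
  by rewrite -ler_pdivrMl ?exprn_gt0 // mulr1.
have : (3 * s%:R - n%:R) ^+ 2 <= 2 * n%:R :> R by exact: h.
nra.
Qed.

(** * Coincidences of blocks *)

Definition same_block (x : binseq) (N i j : nat) : bool :=
  [forall t : 'I_N, x (i + t)%N == x (j + t)%N].

Lemma same_blockP (x : binseq) (N i j : nat) :
  reflect (forall t, (t < N)%N -> x (i + t)%N = x (j + t)%N)
    (same_block x N i j).
Proof.
apply: (iffP forallP) => [h t tN|h t]; last by apply/eqP/h.
exact/eqP/(h (Ordinal tN)).
Qed.

Lemma same_block_sym (x : binseq) (N i j : nat) :
  same_block x N i j = same_block x N j i.
Proof. by apply/same_blockP/same_blockP => h t /h. Qed.

(** A block starting at an even index 2i alternates between 0 and the negated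
    letters from i on, so its floor (N / 2) odd positions determine it. *)
Lemma pd_same_block_even (N i j : nat) :
  same_block period_doubling N i.*2 j.*2 = same_block period_doubling N./2 i j.
Proof.
apply/same_blockP/same_blockP => h t tN.
  have /h : (t.*2.+1 < N)%N by lia.
  by rewrite !addnS -!doubleD !pd_odd => /negb_inj.
rewrite -(odd_double_half t); case: (boolP (odd t)) => ot /=.
  by rewrite add1n !addnS -!doubleD !pd_odd h //; lia.
by rewrite add0n -!doubleD !pd_even.
Qed.

(** Here the informative letters come first in the block, whence the ceiling of
    N / 2. *)
Lemma pd_same_block_odd (N i j : nat) :
  same_block period_doubling N i.*2.+1 j.*2.+1
  = same_block period_doubling (uphalf N) i j.
Proof.
apply/same_blockP/same_blockP => h t tN.
  have /h : (t.*2 < N)%N by lia.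
  by rewrite !addSn -!doubleD !pd_odd => /negb_inj.
rewrite -(odd_double_half t); case: (boolP (odd t)) => ot /=.
  by rewrite add1n !addSn !addnS -!doubleD -!doubleS !pd_even.
by rewrite add0n !addSn -!doubleD !pd_odd h //; lia.
Qed.

Lemma pd_same_block1 (i j : nat) :
  same_block period_doubling 1 i j
  = (period_doubling i && period_doubling j)
    || (~~ period_doubling i && ~~ period_doubling j).
Proof.
transitivity (period_doubling i == period_doubling j); last first.
  by do 2!case: period_doubling.
apply/same_blockP/eqP => [/(_ 0%N isT)|h [|//] _]; by rewrite !addn0.
Qed.

(** The two blocks are 0 ~w_i and ~w_j 0, whose coincidence means that w_i and
    w_j are both 1. *)
Lemma pd_same_block2_mixed (i j : nat) :
  same_block period_doubling 2 i.*2 j.*2.+1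
  = period_doubling i && period_doubling j.
Proof.
apply/same_blockP/andP => [h|[hi hj] [|[|//]] _].
- have := h 0%N isT; have := h 1%N isT.
  rewrite !addn0 !addn1 -doubleS !pd_even !pd_odd => /negbFE -> /esym/negbFE.
  by [].
- by rewrite !addn0 pd_even pd_odd hj.
- by rewrite !addn1 -doubleS pd_even pd_odd hi.
Qed.

Lemma pd_no_11 (i : nat) : ~~ (period_doubling i && period_doubling i.+1).
Proof.
rewrite (period_doublingE i) (period_doublingE i.+1) /=.
by case: (odd i); rewrite ?andbF. Qed.

(** The positions 0 and 2 of the block at the odd index 2j + 1 are the
    negations of w_j and w_(j+1) and face zeros, which would give a factor
    11. *)
Lemma pd_same_block_mixed (N i j : nat) : (3 <= N)%N ->
  same_block period_doubling N i.*2 j.*2.+1 = false.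
Proof.
move=> N3; apply/same_blockP => h; have := pd_no_11 j.
have := h 0%N (leq_trans _ N3); have := h 2%N N3.
rewrite !addn0 !addn2 -!doubleS !pd_even !pd_odd => /esym/negbFE ->.
by move=> /(_ isT)/esym/negbFE ->.
Qed.

(** * Densities of equal blocks *)

Definition block_density (R : realType) (N : nat) (c : R) : Prop :=
  pair_density R (same_block period_doubling N) c.

Lemma block_density0 (R : realType) : block_density R 0 1.
Proof.
apply: pair_density_ext (pair_density_true R) => i j.
by apply/esym/same_blockP.
Qed.

Lemma block_density1 (R : realType) : block_density R 1 (5 / 9).
Proof.
have f1 := pd_frequency R; have f0 := frequency_negb R _ _ f1.
apply: (pair_density_ext R _ _ _ (fun i j => esym (pd_same_block1 i j))).
have -> : 5 / 9 = 1 / 3 * (1 / 3) + (1 - 1 / 3) * (1 - 1 / 3) :> R by field.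
apply: pair_density_disjoint.
- by move=> i j; rewrite /=; case: (period_doubling i); rewrite ?andbF.
- exact: pair_density_prod.
- exact: pair_density_prod.
Qed.

Lemma block_density2 (R : realType) : block_density R 2 (1 / 3).
Proof.
have f1 := pd_frequency R; have b1 := block_density1 R.
have -> : 1 / 3 = (5 / 9 + 1 / 3 * (1 / 3) + 1 / 3 * (1 / 3) + 5 / 9) / 4 :> R.
  by field.
apply: pair_density_double.
- by apply: pair_density_ext b1 => i j; rewrite pd_same_block_even.
- apply: pair_density_ext (pair_density_prod _ _ _ _ _ f1 f1) => i j.
  by rewrite pd_same_block2_mixed.
- apply: pair_density_ext (pair_density_prod _ _ _ _ _ f1 f1) => i j.
  by rewrite same_block_sym pd_same_block2_mixed andbC.
- by apply: pair_density_ext b1 => i j; rewrite pd_same_block_odd.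
Qed.

Lemma block_density_halves (R : realType) (N : nat) (c d : R) : (3 <= N)%N ->
  block_density R N./2 c -> block_density R (uphalf N) d ->
  block_density R N ((c + d) / 4).
Proof.
move=> N3 hc hd.
have -> : (c + d) / 4 = (c + 0 + 0 + d) / 4 by rewrite !addr0.
apply: pair_density_double.
- by apply: pair_density_ext hc => i j; rewrite pd_same_block_even.
- apply: pair_density_ext (pair_density_false R) => i j.
  by rewrite pd_same_block_mixed.
- apply: pair_density_ext (pair_density_false R) => i j.
  by rewrite same_block_sym pd_same_block_mixed.
- by apply: pair_density_ext hd => i j; rewrite pd_same_block_odd.
Qed.

Lemma block_density_exists (R : realType) (N : nat) :
  exists c, block_density R N c.
Proof.
elim/ltn_ind: N => [[|[|[|N]]]] IH.
- by exists 1; exact: block_density0.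
- by exists (5 / 9); exact: block_density1.
- by exists (1 / 3); exact: block_density2.
have [|c hc] := IH N.+3./2; first by lia.
have [|d hd] := IH (uphalf N.+3); first by lia.
by exists ((c + d) / 4); apply: block_density_halves.
Qed.

Definition affine_block_density (R : realType) (a b : nat) (u v : R) : Prop :=
  forall N, (a <= N <= b)%N -> block_density R N (u - v * N%:R).

(** Halving the length halves the affine argument on average, since
    floor (N / 2) + ceil (N / 2) = N. Both halves stay in [a, b], and
    2 <= a guarantees that the halving recurrence applies on all of [2a, 2b].
*)
Lemma affine_block_density_double (R : realType) (a b : nat) (u v : R) :
  (2 <= a)%N -> affine_block_density R a b u v ->
  affine_block_density R a.*2 b.*2 (u / 2) (v / 4).
Proof.
move=> a2 h N /andP[aN Nb].
have -> : u / 2 - v / 4 * N%:R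
    = ((u - v * N./2%:R) + (u - v * (uphalf N)%:R)) / 4 :> R.
  have {1}-> : N = (N./2 + uphalf N)%N by lia.
  by rewrite natrD; field.
by apply: block_density_halves; [lia|apply: h; lia|apply: h; lia].
Qed.

Lemma affine_block_density_scale (R : realType) (a b j : nat) (u v : R) :
  (2 <= a)%N -> affine_block_density R a b u v ->
  affine_block_density R (2 ^ j * a) (2 ^ j * b) (u / 2 ^+ j) (v / 4 ^+ j).
Proof.
move=> a2 h; elim: j => [|j IH].
  by rewrite !mul1n !expr0 !divr1.
have := affine_block_density_double R _ _ _ _ _ IH.
rewrite !exprSr !invfM !mulrA !expnS -!mul2n -!mulnA; apply.
by rewrite -[2%N]mul1n leq_mul // expn_gt0.
Qed.

(** Two points determine an affine function: c(2) = 3/9 and c(3) = 2/9. *)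
Lemma affine_block_density_2_3 (R : realType) :
  affine_block_density R 2 3 (5 / 9) (1 / 9).
Proof.
move=> N hN; have /orP[] : (N == 2) || (N == 3) by lia.
  move=> /eqP->; have -> : 5 / 9 - 1 / 9 * 2 = 1 / 3 :> R by field.
  exact: block_density2.
move=> /eqP->; have -> : 5 / 9 - 1 / 9 * 3 = (5 / 9 + 1 / 3) / 4 :> R by field.
apply: block_density_halves => //; [exact: block_density1|].
exact: block_density2.
Qed.

(** Likewise from c(3) = 4/18 and c(4) = 3/18. *)
Lemma affine_block_density_3_4 (R : realType) :
  affine_block_density R 3 4 (7 / 18) (1 / 18).
Proof.
move=> N hN; have /orP[] : (N == 3) || (N == 4) by lia.
  move=> /eqP->.
  have -> : 7 / 18 - 1 / 18 * 3 = 5 / 9 - 1 / 9 * 3 :> R by field.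
  exact: affine_block_density_2_3.
move=> /eqP->.
have -> : 7 / 18 - 1 / 18 * 4 = (1 / 3 + 1 / 3) / 4 :> R by field.
by apply: block_density_halves => //; exact: block_density2.
Qed.

(** * From Bowen's metric to blocks *)

Lemma iter_shift (x : binseq) (i t : nat) : iter i Defs.shift x t = x (i + t)%N.
Proof.
by elim: i t => [//|i IH] t; rewrite iterS /Defs.shift IH addnS addSn.
Qed.

(** Distances are 0 or of the form 2 ^ -k, and m is the threshold for which
    2 ^ -k <= eps amounts to m <= k. *)
Lemma rho_leP (R : realType) (eps : R) (m : nat) (a b : binseq) :
  0 < eps -> is_m_eps eps m ->
  (rho a b <= eps) <-> (forall t, (t < m)%N -> a t = b t).
Proof.
move=> e0 hm.
have mE k : (2 ^- k <= eps) = (m <= k)%N.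
  move: hm; rewrite /is_m_eps; case: ifPn => [e1 ->|_ [m0 /andP[le_me lt_em]]].
    by rewrite (le_trans _ e1) // invf_le1 ?exprn_gt0 // exprn_ege1 // ler1n.
  case: leqP => [mk|km].
    apply: le_trans le_me.
    by rewrite lef_pV2 ?posrE ?exprn_gt0 // ler_weXn2l // ler1n.
  apply/negbTE; rewrite -ltNge; apply: (lt_le_trans lt_em).
  by rewrite lef_pV2 ?posrE ?exprn_gt0 // ler_weXn2l ?ler1n //; lia.
have [h|h] := pselect (exists i, a i != b i); last first.
  have ab : a = b.
    apply/funext => i; apply/eqP/negPn/negP => ne; apply: h.
    by exists i.
  by rewrite ab rho_eq ltW.
case: (ex_minnP h) => k dk mink.
rewrite (rho_first_diff R dk) ?mE; last first.
  by move=> i ik; apply/eqP/negPn/negP => /mink; rewrite leqNgt ik.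
split=> [mk t tm|eqm].
  by apply/eqP/negPn/negP => /mink; lia.
by rewrite leqNgt; apply/negP => /eqm/eqP; rewrite (negbTE dk).
Qed.

Lemma bowen_le (R : realType) (eps : R) (m l : nat) (x : binseq) (i j : nat) :
  0 < eps -> is_m_eps eps m -> (0 < l)%N ->
  (bowen l (iter i Defs.shift x) (iter j Defs.shift x) <= eps)
  = same_block x (if m == 0%N then 0 else m + l - 1)%N i j.
Proof.
move=> e0 hm l0.
have rhoE k : (rho (iter k Defs.shift (iter i Defs.shift x))
      (iter k Defs.shift (iter j Defs.shift x)) <= eps)
    <-> (forall t, (t < m)%N -> x (i + (k + t))%N = x (j + (k + t))%N).
  rewrite (rho_leP R _ _ _ _ e0 hm).
  by split=> h t /h; rewrite !iter_shift.
apply/bigmax_leP/same_blockP => [[_ h] s sN|h].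
  have m0 : (0 < m)%N by case: (m) sN.
  (* The letter s is seen by the k-th shift for some k < l and some offset
     below m; the largest possible k will do. *)
  have kl : (minn s l.-1 < l)%N by lia.
  have := (rhoE _).1 (h (Ordinal kl) isT) (s - minn s l.-1)%N.
  by rewrite /= subnKC ?geq_minl //; apply; move: sN; rewrite gtn_eqF //; lia.
split=> [|k _]; first exact: ltW.
apply/rhoE => t tm; apply: h; have := ltn_ord k.
by case: eqP => [m0|_]; lia.
Qed.

Lemma corr_sum_pair_count (R : realType) (eps : R) (m l n : nat) (x : binseq) :
  0 < eps -> is_m_eps eps m -> (0 < l)%N ->
  corr_sum l x n eps
  = (pair_count (same_block x (if m == 0%N then 0 else m + l - 1)%N) n)%:R
    / n%:R ^+ 2.
Proof.
move=> e0 hm l0; rewrite /corr_sum; congr (_%:R / _).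
rewrite /pair_count pair_bigA -sum1_card big_mkcond /=.
by apply: eq_bigr => p _; rewrite inE (bowen_le R eps m) //; case: same_block.
Qed.

(** * The recurrence rate *)

Lemma rec_rate_cvg (R : realType) (eps : R) (m l : nat) (c d : R) :
  0 < eps -> is_m_eps eps m -> (0 < l)%N ->
  block_density R (if m == 0%N then 0 else m + l - 1)%N c ->
  block_density R (if m == 0%N then 0 else m + l)%N d ->
  (fun n => rec_rate l period_doubling n eps) @ \oo
    --> c + (l%:R - 1) * (c - d).
Proof.
move=> e0 hm l0 hc hd.
have -> : c + (l%:R - 1) * (c - d) = l%:R * c - (l%:R - 1) * d by ring.
have E n : rec_rate l period_doubling n eps = l%:R
    * ((pair_count (same_block period_doubling
         (if m == 0%N then 0 else m + l - 1)%N) n)%:R / n%:R ^+ 2)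
  - (l%:R - 1) * ((pair_count (same_block period_doubling
         (if m == 0%N then 0 else m + l)%N) n)%:R / n%:R ^+ 2).
  rewrite /rec_rate !(corr_sum_pair_count R eps m) //.
  by have -> : (m + l.+1 - 1 = m + l)%N by lia.
under eq_fun => n do rewrite E.
by apply: cvgB; apply: cvgM => //; apply: cvg_cst.
Qed.

Lemma rec_rate_limE (R : realType) (eps : R) (m l : nat) (c d : R) :
  0 < eps -> is_m_eps eps m -> (0 < l)%N ->
  block_density R (if m == 0%N then 0 else m + l - 1)%N c ->
  block_density R (if m == 0%N then 0 else m + l)%N d ->
  rec_rate_lim l period_doubling eps = c + (l%:R - 1) * (c - d).
Proof. by move=> *; apply: cvg_lim => //; apply: (rec_rate_cvg _ _ m). Qed.

(** On an affine piece, c(N) - c(N + 1) is the slope v. *)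
Lemma rec_rate_lim_affine (R : realType) (eps : R) (m l a b : nat) (u v : R) :
  0 < eps -> is_m_eps eps m -> (0 < l)%N -> (0 < m)%N ->
  affine_block_density R a b u v -> (a <= m + l - 1)%N -> (m + l <= b)%N ->
  rec_rate_lim l period_doubling eps
  = u - v * (m + l - 1)%:R + v * (l%:R - 1).
Proof.
move=> e0 hm l0 m0 h aN Nb.
rewrite (rec_rate_limE R eps m l
  (u - v * (m + l - 1)%:R) (u - v * (m + l)%:R)) //.
- have -> : (m + l)%:R = (m + l - 1)%:R + 1 :> R.
    by rewrite -[1]/(1%:R) -natrD; congr _%:R; lia.
  by ring.
- by rewrite gtn_eqF //; apply: h; lia.
- by rewrite gtn_eqF //; apply: h; lia.
Qed.

Theorem theorem1p5 (R : realType) (l : nat) (eps : R)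
    (hl : (1 <= l)%N) (heps : 0 < eps) :
  let m := m_eps eps in
  let RR := rec_rate_lim l period_doubling eps in
  [/\ cvgn (fun n => rec_rate l period_doubling n eps),
      m = 0%N -> RR = 1,
      m = 1%N -> l = 1%N -> RR = 5 / 9 &
      (1 <= m)%N -> (3 <= m + l)%N ->
      forall k q : nat, is_dyadic_split (m + l - 1)%N k q ->
        ((q < 2 ^ (k - 1))%N ->
           RR = (3 * 2 ^+ (k + 1) - 4 * q%:R + 4 * l%:R - 4)
                / (3 * 2 ^+ k) ^+ 2) /\
        ((2 ^ (k - 1) <= q)%N ->
           RR = (5 * 2 ^+ k - 2 * q%:R + 2 * l%:R - 2)
                / (3 * 2 ^+ k) ^+ 2)].
Proof.
move=> m RR; have hm : is_m_eps eps m := m_epsP heps.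
split.
- have [c hc] := block_density_exists R (if m == 0%N then 0 else m + l - 1)%N.
  have [d hd] := block_density_exists R (if m == 0%N then 0 else m + l)%N.
  by apply: cvgP; exact: (rec_rate_cvg R eps m l c d).
- move=> m0; rewrite /RR (rec_rate_limE R eps m l 1 1) //.
  + by rewrite subrr mulr0 addr0.
  + by rewrite m0; exact: block_density0.
  + by rewrite m0; exact: block_density0.
- move=> m1 l1; rewrite /RR (rec_rate_limE R eps m l (5 / 9) (1 / 3)) //.
  + by rewrite l1 subrr mul0r addr0.
  + by rewrite m1 l1; exact: block_density1.
  + by rewrite m1 l1; exact: block_density2.
move=> m1 ml k q [k1 qk N_eq].
(* The exponent j = k - 1 counts the doublings from [2, 4] to [2^k, 2^(k+1)]. *)
have [j kE] : exists j, k = j.+1 by exists k.-1; rewrite prednK.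
have p0 : (2 ^+ j : R) != 0 by rewrite expf_neq0.
have four : (4 ^+ j : R) = (2 ^+ j) ^+ 2.
  by rewrite -exprM mulnC exprM; congr (_ ^+ _); ring.
have pow2 : (2 ^ k = 2 * 2 ^ j)%N by rewrite kE expnS.
have NR : (m + l - 1)%:R = 2 * 2 ^+ j + q%:R :> R.
  by rewrite N_eq natrD pow2 natrM natrX.
rewrite kE subn1 addn1 /=; split=> hq.
- have h := affine_block_density_scale R 2 3 j _ _ isT
    (affine_block_density_2_3 R).
  rewrite /RR (rec_rate_lim_affine R eps m l _ _ _ _ heps hm hl m1 h); try lia.
  by rewrite NR four !exprS; field.
- have h := affine_block_density_scale R 3 4 j _ _ isT
    (affine_block_density_3_4 R).
  rewrite /RR (rec_rate_lim_affine R eps m l _ _ _ _ heps hm hl m1 h); try lia.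
  by rewrite NR four !exprS; field.
Qed.
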